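(* Let $k,m$ be positive integers, $n=4k$, and let $A\in\mathbb{R}^{m\times n}$ have $2k$-restricted isometry constant $\delta_{2k}\in[\frac{\sqrt{2}}{2},1)$. Let $x\in\mathbb{R}^n$, $\epsilon\ge 0$, $e\in\mathbb{R}^m$ with $\|e\|_2\le\epsilon$, and $y=Ax+e$. For $p\in(0,1)$ let $x^{\star}$ be a solution of $\min_{\gamma\in\mathbb{R}^n}\|\gamma\|_p$ subject to $\|y-A\gamma\|_2\le\epsilon$, and let $T_0^c=\{k+1,\dots,n\}$. Let $$\bar C(p)=(1+\delta_{2k})2^{\frac p2-1}\Big(\frac{g(p)}{1-\delta_{2k}}\Big)^{p/2},\qquad \bar D(p)=\Big(\frac{2g(p)}{1-\delta_{2k}}\Big)^{p/2}.$$ Then for each $p\in(0,1)$ with $\bar C(p)<1$, $$\|x-x^{\star}\|_2^p\le \bar D_0k^{\frac p2-1}\|x_{T_0^c}\|_p^p+\bar D_1\epsilon^p,\qquad \bar D_0=\frac{2\bar D(p)}{1-\bar C(p)},\quad \bar D_1=\frac{2^p}{(1-\delta_{2k})^{\frac p2}}\Big(1+\frac{2\bar D(p)}{1-\bar C(p)}\Big).$$ In particular, if $\epsilon=0$ and $x$ is $k$-sparse, then $x^{\star}=x$.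
   Context: For $1\le s\le n$, the $s$-restricted isometry constant $\delta_s$ of $A$ is the smallest constant such that $(1-\delta_s)\|z\|_2^2\le\|Az\|_2^2\le(1+\delta_s)\|z\|_2^2$ for all $s$-sparse $z\in\mathbb{R}^n$. For $p\in(0,1)$, $\|\gamma\|_p=(\sum_i|\gamma_i|^p)^{1/p}$. For a vector $v$ and index set $T$, $v_T$ is the vector equal to $v$ on $T$ and zero elsewhere. $g(p)=\frac{p}{2}(1-\frac{p}{2})^{\frac{2}{p}-1}$. *)

(* Defs.v *)
From HB Require Import structures.
From mathcomp Require Import all_boot all_order all_algebra.
From mathcomp Require Import all_classical all_reals all_analysis.
Set Implicit Arguments. Unset Strict Implicit. Unset Printing Implicit Defensive.
Import Order.TTheory GRing.Theory Num.Theory.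
Local Open Scope ring_scope.

Section Defs.
Variable R : realType.

Definition l2norm n (z : 'cV[R]_n) : R := Num.sqrt (\sum_i (z i 0) ^+ 2).

Definition lpnorm n (p : R) (z : 'cV[R]_n) : R :=
  (\sum_i `|z i 0| `^ p) `^ (1 / p).

Definition sparse n (s : nat) (z : 'cV[R]_n) : Prop :=
  (#|[set i | z i ord0 != 0%R]| <= s)%N.

Definition restrictT n (v : 'cV[R]_n) (T : {set 'I_n}) : 'cV[R]_n :=
  \col_i (if i \in T then v i 0 else 0).

Definition RIP_bound m n (A : 'M[R]_(m, n)) (s : nat) (d : R) : Prop :=
  forall z : 'cV[R]_n, sparse s z ->
    (1 - d) * l2norm z ^+ 2 <= l2norm (A *m z) ^+ 2 /\
    l2norm (A *m z) ^+ 2 <= (1 + d) * l2norm z ^+ 2.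

Definition is_RIC m n (A : 'M[R]_(m, n)) (s : nat) (d : R) : Prop :=
  RIP_bound A s d /\ forall d', RIP_bound A s d' -> d <= d'.

Definition lp_minimizer m n (A : 'M[R]_(m, n)) (y : 'cV[R]_m) (eps p : R)
  (xs : 'cV[R]_n) : Prop :=
  l2norm (y - A *m xs) <= eps /\
  forall gamma : 'cV[R]_n, l2norm (y - A *m gamma) <= eps ->
    lpnorm p xs <= lpnorm p gamma.

Definition gfun (p : R) : R := p / 2 * (1 - p / 2) `^ (2 / p - 1).

Definition Cbar (d p : R) : R :=
  (1 + d) * 2 `^ (p / 2 - 1) * (gfun p / (1 - d)) `^ (p / 2).

Definition Dbar (d p : R) : R := (2 * gfun p / (1 - d)) `^ (p / 2).

End Defs.

(* Main.v *)
(** Let h = x - x*. Minimality of x* and subadditivity of t^p give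
    ||h_{T^c}||_p^p <= ||h_T||_p^p + 2 ||x_{T^c}||_p^p for every T of size at most k, so T
    may be replaced by the set S of the k largest entries of h. Let t be the least of
    the next k entries (in modulus), u = (k t^p)^-1 * (the p-th power sum of the 2k
    smallest entries) and kap = t sqrt k. Since n = 4k, both the 2k largest and the 2k
    smallest entries form 2k-sparse vectors, and the restricted isometry property with
    ||A h|| <= 2 eps compares their l2-norms. The squared l2-norm of the 2k smallest
    entries is at most kap^2 u and that of the second block at least kap^2, while
    kap^p (1 + u) <= k^(p/2-1) ||h_{S^c}||_p^p. Everything then follows from the scalar
    inequality X - 1 <= g(p) X^(2/p): at X = 1 + u it bounds the tail, and at
    X = (1 + delta) (1 + u) / 2 it gives the constant C(p), because with
    M = (1 + delta) / (1 - delta) one has X - 1 = (M u - 1) / (M + 1). *)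

Require Import Defs.
From HB Require Import structures.
From mathcomp Require Import all_boot all_order all_algebra.
From mathcomp Require Import all_classical all_reals all_analysis.
From mathcomp Require Import ring lra.
Import Order.TTheory GRing.Theory Num.Theory.
Local Open Scope ring_scope.

(** * Elementary inequalities for real powers *)

(** Young's inequality for [z] and [1] with conjugate exponents [r] and [(1 - r^-1)^-1], multiplied
    by [r]. *)
Lemma bernoulli_powR {R : realType} (r z : R) :
  1 < r -> 0 <= z -> 1 + r * (z - 1) <= z `^ r.
Proof.
move=> r1 z0; have r0 : 0 < r by lra.
have q0 : 0 < 1 - r^-1 by rewrite subr_gt0 invf_lt1.
have qv0 : 0 < (1 - r^-1)^-1 by rewrite invr_gt0.
have := @conjugate_powR R z 1 r (1 - r^-1)^-1 z0 ler01 r0 qv0.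
rewrite invrK mulr1 powR1 mul1r => /(_ (subrKC _ _)) H.
have := ler_wpM2l (ltW r0) H.
rewrite mulrDr mulrCA mulfV ?gt_eqF// mulr1 mulrBr mulr1 mulfV ?gt_eqF//; lra.
Qed.

(** Bernoulli with exponent [s^-1], taken at the [s]-th power of [z]. *)
Lemma powR_le_tangent {R : realType} (s z : R) :
  0 < s < 1 -> 0 <= z -> z `^ s <= 1 + s * (z - 1).
Proof.
move=> /andP[s0 s1] z0.
have sV1 : 1 < s^-1 by rewrite invf_gt1.
have := bernoulli_powR s^-1 (z `^ s) sV1 (powR_ge0 _ _).
rewrite -powRrM divff ?gt_eqF// powRr1// => H.
have := ler_wpM2l (ltW s0) H.
rewrite mulrDr mulrA divff ?gt_eqF// mul1r mulr1; lra.
Qed.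

(** The share of each summand in [a + b] lies in [0, 1], hence is at most its own [p]-th power; the
    two shares add up to 1. *)
Lemma powR_subadditive {R : realType} (p a b : R) :
  0 < p <= 1 -> 0 <= a -> 0 <= b -> (a + b) `^ p <= a `^ p + b `^ p.
Proof.
move=> /andP[p0 p1] a0 b0.
have [s0|] := ltP 0 (a + b); last first.
  move=> ab; have -> : a + b = 0 by lra.
  by rewrite powR0 ?gt_eqF// addr_ge0// powR_ge0.
have part (c : R) : 0 <= c -> c <= a + b -> c / (a + b) * (a + b) `^ p <= c `^ p.
  move=> c0 cab; have [->|cN0] := eqVneq c 0.
    by rewrite !mul0r powR_ge0.
  have cpos : 0 < c by rewrite lt0r cN0.
  have cs : 0 < c / (a + b) by rewrite divr_gt0.
  have -> : c `^ p = (c / (a + b)) `^ p * (a + b) `^ p.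
    by rewrite -powRM ?divfK ?gt_eqF// ltW.
  rewrite ler_wpM2r ?powR_ge0// ger1_powR// cs /=.
  by rewrite ler_pdivrMr// mul1r.
have := lerD (part a a0 _) (part b b0 _); rewrite -mulrDl -mulrDl divff ?gt_eqF//.
by rewrite mul1r; apply; lra.
Qed.

(** * The constants g(p), C(p) and D(p) *)

Lemma gfun_ge0 {R : realType} (p : R) : 0 < p -> 0 <= gfun p.
Proof. by move=> p0; rewrite /gfun mulr_ge0 ?powR_ge0// divr_ge0// ltW. Qed.

(* Bernoulli at [(1 - p/2) * X]; equality holds at [X = 1 / (1 - p/2)]. *)
Lemma sub1_le_gfun_powR {R : realType} (p X : R) :
  0 < p < 1 -> 0 <= X -> X - 1 <= gfun p * X `^ (2 / p).
Proof.
move=> /andP[p0 p1] X0.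
have r1 : 1 < 2 / p by rewrite ltr_pdivlMr//; lra.
have v0 : 0 < 1 - p / 2 by lra.
have vX : 0 <= (1 - p / 2) * X by rewrite mulr_ge0// ltW.
have B := bernoulli_powR _ _ r1 vX.
rewrite -(ler_pM2l v0).
have -> : (1 - p / 2) * (gfun p * X `^ (2 / p)) =
    p / 2 * ((1 - p / 2) * X) `^ (2 / p).
  have r0 : 0 < 2 / p by lra.
  rewrite powRM// ?ltW// /gfun -[(1 - p / 2) `^ (2 / p)](mulr_powRB1 (ltW v0) r0).
  by move: (_ `^ (_ - 1)) (X `^ _) => V W; ring.
have p20 : 0 <= p / 2 by lra.
apply: le_trans (ler_wpM2l p20 B).
have -> : p / 2 * (1 + 2 / p * ((1 - p / 2) * X - 1)) =
    p / 2 + ((1 - p / 2) * X - 1) by field; rewrite gt_eqF.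
lra.
Qed.

Lemma powRK_half {R : realType} (p X : R) :
  0 < p -> 0 <= X -> (X `^ (2 / p)) `^ (p / 2) = X.
Proof.
move=> p0 X0; rewrite -powRrM.
have -> : 2 / p * (p / 2) = 1 by field; rewrite gt_eqF.
exact: powRr1.
Qed.

Lemma powR_half_tail {R : realType} (p u : R) :
  0 < p < 1 -> 0 <= u -> u `^ (p / 2) <= gfun p `^ (p / 2) * (1 + u).
Proof.
move=> p01 u0; have /andP[p0 p1] := p01.
have u1 : 0 <= 1 + u by lra.
have := sub1_le_gfun_powR p (1 + u) p01 u1.
have -> : 1 + u - 1 = u by ring.
have g0 := gfun_ge0 p p0.
have p2 : 0 <= p / 2 by lra.
move=> /(ge0_ler_powR p2); rewrite !nnegrE mulr_ge0 ?powR_ge0// => /(_ u0 isT).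
by rewrite powRM ?powR_ge0// powRK_half.
Qed.

Lemma CbarE {R : realType} (d p : R) : 0 < p -> d < 1 ->
  Cbar d p = (1 + d) / 2 * Dbar d p.
Proof.
move=> p0 d1; have d0 : 0 < 1 - d by lra.
have g0 : 0 <= gfun p / (1 - d) by rewrite divr_ge0 ?gfun_ge0// ltW.
rewrite /Cbar /Dbar -(mulrA 2) [(2 * _) `^ _]powRM//.
rewrite powRB; last by rewrite pnatr_eq0 implybT.
by rewrite powRr1// !mulrA [(1 + d) * _ / 2]mulrAC.
Qed.

Lemma Dbar_ge0 {R : realType} (d p : R) : 0 <= Dbar d p.
Proof. exact: powR_ge0. Qed.

Lemma powR_half_Cbar {R : realType} (d p u : R) :
    0 < p < 1 -> 0 <= d < 1 -> 0 <= u -> 1 <= (1 + d) / (1 - d) * u ->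
  ((1 + d) / (1 - d) * u - 1) `^ (p / 2) <= Cbar d p * (1 + u).
Proof.
move=> p01 /andP[d0 d1] u0 Mu1; have /andP[p0 p1] := p01.
have e0 : 0 < 1 - d by lra.
have X0 : 0 <= (1 + d) / 2 * (1 + u) by rewrite mulr_ge0//; lra.
have H := sub1_le_gfun_powR p _ p01 X0.
have f0 : 0 <= 2 / (1 - d) by rewrite divr_ge0// ltW.
have {}H := ler_wpM2l f0 H.
(* With M = (1 + d) / (1 - d), the factor [2 / (1 - d)] is M + 1 and [(1 + d) / 2] is M / (M + 1),
   so the terms free of [u] collapse to -1. *)
have E : 2 / (1 - d) * ((1 + d) / 2 * (1 + u) - 1) = (1 + d) / (1 - d) * u - 1.
  by field; rewrite gt_eqF.
rewrite E (mulrA (2 / (1 - d)) (gfun p)) in H.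
have g0 := gfun_ge0 p p0.
have fg0 : 0 <= 2 / (1 - d) * gfun p by rewrite mulr_ge0.
have p2 : 0 <= p / 2 by lra.
move/(ge0_ler_powR p2): H; rewrite !nnegrE subr_ge0 mulr_ge0 ?powR_ge0//.
move=> /(_ Mu1 isT); rewrite [leRHS]powRM ?powR_ge0// powRK_half// CbarE// /Dbar.
by rewrite (mulrAC 2) => /le_trans; apply; rewrite mulrCA mulrA.
Qed.

(** * Scalar estimate of the head under noise *)

(** The function sqrt (t^2 - 1) has slope at most sqrt 2 for t >= sqrt 2. Without derivatives: [b]
    is at most sqrt 2 times sqrt (b^2 - 1), which controls the cross term after squaring. *)
Lemma le_of_sqr_add1 {R : realType} (a b eta : R) :
    0 <= eta -> Num.sqrt 2 <= b -> a ^+ 2 + 1 <= (eta + b) ^+ 2 ->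
  a <= Num.sqrt (b ^+ 2 - 1) + Num.sqrt 2 * eta.
Proof.
move=> eta0 hb H.
have s0 : 0 <= Num.sqrt 2 :> R := sqrtr_ge0 _.
have s2 : Num.sqrt 2 ^+ 2 = 2 :> R by rewrite sqr_sqrtr.
have b0 : 0 <= b by lra.
have b2 : 2 <= b ^+ 2 by rewrite -s2 ler_sqr ?nnegrE.
set c := Num.sqrt (b ^+ 2 - 1).
have c0 : 0 <= c := sqrtr_ge0 _.
have c2 : c ^+ 2 = b ^+ 2 - 1 by rewrite sqr_sqrtr//; lra.
have bc : b <= Num.sqrt 2 * c.
  by rewrite -ler_sqr ?nnegrE ?mulr_ge0// exprMn s2 c2; lra.
have [a0|] := leP 0 a; last first.
  by move=> an; apply: (le_trans (ltW an)); rewrite addr_ge0// mulr_ge0.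
rewrite -ler_sqr ?nnegrE ?addr_ge0 ?mulr_ge0//.
have := ler_wpM2r eta0 bc.
rewrite sqrrD exprMn s2 c2; move: H; rewrite sqrrD !mulr2n; nra.
Qed.

Lemma powR_sqrt2_le {R : realType} (p z : R) : 0 < p < 1 -> 0 <= z ->
  (Num.sqrt 2 * z) `^ p <= Num.sqrt 2 * z `^ p.
Proof.
move=> /andP[p0 p1] z0; rewrite powRM// ?sqrtr_ge0// ler_wpM2r ?powR_ge0//.
have s1 : 1 <= Num.sqrt 2 :> R by rewrite -{1}sqrtr1 ler_sqrt//; lra.
by rewrite -[leRHS]powRr1 ?sqrtr_ge0// ler_powR// ltW.
Qed.

(* The noise [eta] enters inside a square from which 1 is then subtracted. If
   [M u >= 2] the square root has slope at most [sqrt 2] there; if [M u < 2] then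
   [a >= 1] forces [eta] to be at least [sqrt 2 - sqrt (M u)], and the bound
   [1 <= C(p) (1 + 2 / M)] loses at most [(2 - sqrt 2) * eta `^ p]. This second case
   is the one place where [d >= sqrt 2 / 2] matters. *)
Lemma head_powR_le {R : realType} (d p a u eta : R) :
    0 < p < 1 -> Num.sqrt 2 / 2 <= d < 1 -> 1 <= a -> 0 <= u -> 0 <= eta ->
    a ^+ 2 + 1 <= (eta + Num.sqrt ((1 + d) / (1 - d) * u)) ^+ 2 ->
  a `^ p <= Cbar d p * (1 + u) + 2 * eta `^ p.
Proof.
move=> p01 /andP[hd d1] a1 u0 eta0 H; have /andP[p0 p1] := p01.
set s := Num.sqrt 2 : R in hd *.
have s0 : 0 <= s := sqrtr_ge0 _.
have s2 : s ^+ 2 = 2 by rewrite sqr_sqrtr.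
have s15 : s <= 3 / 2 by rewrite -ler_sqr ?nnegrE// s2; lra.
have s1 : 1 <= s by rewrite -ler_sqr ?nnegrE// s2; lra.
have d0 : 0 <= d < 1 by rewrite d1 andbT; lra.
set M := (1 + d) / (1 - d) in H *.
(* The bound is the value of [M] at [d = sqrt 2 / 2]. *)
have M3 : 3 + 2 * s <= M.
  rewrite ler_pdivlMr ?subr_gt0//.
  have s4 : 0 <= 4 + 2 * s by lra.
  have := ler_wpM2r s4 hd.
  have -> : s / 2 * (4 + 2 * s) = 2 * s + s ^+ 2 by field.
  by rewrite s2; lra.
have Mu0 : 0 <= M * u by rewrite mulr_ge0//; lra.
set b := Num.sqrt (M * u) in H.
have b0 : 0 <= b := sqrtr_ge0 _.
have b2 : b ^+ 2 = M * u by rewrite sqr_sqrtr.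
have ep0 := powR_ge0 eta p.
have p0' := ltW p0.
have [sb|bs] := leP s b.
  have Mu1 : 1 <= M * u by rewrite -b2 expr_ge1//; lra.
  have := le_of_sqr_add1 a b eta eta0 sb H.
  rewrite -/s b2; set c := Num.sqrt _ => ac.
  have c0 : 0 <= c := sqrtr_ge0 _.
  apply: (@le_trans _ _ ((c + s * eta) `^ p)).
    by apply: ge0_ler_powR => //; rewrite nnegrE ?addr_ge0 ?mulr_ge0//; lra.
  apply: le_trans (powR_subadditive _ _ _ _ _ _) _; rewrite ?mulr_ge0//.
    by rewrite p0 ltW.
  apply: lerD; last first.
    apply: le_trans (powR_sqrt2_le _ _ p01 eta0) _.
    by rewrite -/s ler_wpM2r//; lra.
  have := powR_half_Cbar d p u p01 d0 u0 Mu1.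
  by rewrite -/M (mulrC p) powRrM powR12_sqrt ?subr_ge0.
have M0 : 0 < M by lra.
have zeta : s - b <= eta.
  have : 0 <= eta + b by rewrite addr_ge0.
  have : 2 <= (eta + b) ^+ 2 by apply: le_trans H; rewrite -[2]/(1 + 1) lerD2r expr_ge1//; lra.
  rewrite -s2 => /[swap] eb0; rewrite ler_sqr ?nnegrE//; lra.
have H' : a ^+ 2 + 1 <= (eta + s) ^+ 2.
  by apply: le_trans H _; rewrite ler_sqr ?nnegrE ?addr_ge0// lerD2l ltW.
have := le_of_sqr_add1 a s eta eta0 (lexx _) H'.
rewrite s2 -/s (_ : 2 - 1 = 1); last by ring.
rewrite sqrtr1 => ac.
have {ac} ap : a `^ p <= 1 + s * eta `^ p.
  apply: (@le_trans _ _ ((1 + s * eta) `^ p)).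
    by apply: ge0_ler_powR => //; rewrite nnegrE ?addr_ge0 ?mulr_ge0//; lra.
  apply: le_trans (powR_subadditive _ _ _ _ _ _) _; rewrite ?mulr_ge0//.
    by rewrite p0 ltW.
  by rewrite powR1 lerD2l; apply: powR_sqrt2_le.
(* The boundary value [M * u = 2], where the left side of [powR_half_Cbar] equals 1. *)
have C1 : 1 <= Cbar d p * (1 + 2 / M).
  have M2 : M * (2 / M) = 2 by rewrite mulrCA divff ?mulr1// gt_eqF.
  have := powR_half_Cbar d p (2 / M) p01 d0.
  rewrite -/M M2 divr_ge0//; last lra.
  rewrite (_ : 2 - 1 = 1); last by ring.
  by rewrite powR1; apply => //; lra.
(* In other words, C(p) (1 + u) falls short of 1 by at most (2 - b^2) / (M + 2). It remains to
   absorb this deficit into [(2 - s)] times the [p]-th power of [eta]. *)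
have C2 : M + b ^+ 2 <= Cbar d p * (1 + u) * (M + 2).
  rewrite b2.
  have : (1 + u) * M <= Cbar d p * (1 + 2 / M) * ((1 + u) * M).
    by apply: ler_peMl => //; rewrite mulr_ge0//; lra.
  have -> : Cbar d p * (1 + 2 / M) * ((1 + u) * M) = Cbar d p * (1 + u) * (M + 2).
    by field; rewrite gt_eqF.
  lra.
(* The ratio (s - b) / s lies in (0, 1], so passing to its [p]-th power increases it; being at most
   [s - b], it is also at most [eta]. *)
have zp : s - b <= s * eta `^ p.
  have z0 : 0 < s - b by lra.
  have sp : 0 < s by lra.
  apply: (@le_trans _ _ (s * ((s - b) / s) `^ p)).
    have dv : s * ((s - b) / s) = s - b by rewrite mulrC divfK ?gt_eqF.
    rewrite -{1}dv; apply: ler_wpM2l => //; apply: ger1_powR; last exact: ltW.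
    by rewrite divr_gt0//= ler_pdivrMr//; lra.
  apply: ler_wpM2l => //; apply: ge0_ler_powR => //; rewrite ?nnegrE//.
    by rewrite divr_ge0// ltW.
  by apply: le_trans zeta; rewrite ler_pdivrMr// ler_peMr// ltW.
have K : 2 - b ^+ 2 <= 4 * eta `^ p.
  have zs0 : 0 <= s - b by lra.
  have sb0 : 0 <= s + b by lra.
  have sbs : s + b <= s + s by lra.
  have := ler_pM zs0 sb0 zp sbs.
  have -> : s * eta `^ p * (s + s) = 2 * s ^+ 2 * eta `^ p by ring.
  by rewrite -subr_sqr s2; lra.
have N : 4 <= (2 - s) * (M + 2).
  have t0 : 0 <= 2 - s by lra.
  have t1 : 5 + 2 * s <= M + 2 by lra.
  apply: le_trans (ler_wpM2l t0 t1).
  have -> : (2 - s) * (5 + 2 * s) = 10 - s - 2 * s ^+ 2 by ring.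
  by rewrite s2; lra.
have {}N := ler_wpM2r ep0 N.
have M2 : 0 < M + 2 by lra.
apply: (le_trans ap); rewrite -(ler_pM2r M2).
rewrite [leRHS]mulrDl; move: C2 N K; move: (_ * _ * (M + 2)) (eta `^ p) => W E.
have -> : (2 - s) * (M + 2) * E = 2 * E * (M + 2) - s * E * (M + 2) by ring.
rewrite mulrDl; lra.
Qed.

(** * The Euclidean norm and restriction to index sets *)

Lemma l2norm_ge0 {R : realType} {n} (z : 'cV[R]_n) : 0 <= l2norm z.
Proof. exact: sqrtr_ge0. Qed.

Lemma sqr_l2norm {R : realType} {n} (z : 'cV[R]_n) :
  l2norm z ^+ 2 = \sum_i z i 0 ^+ 2.
Proof. by rewrite sqr_sqrtr// sumr_ge0// => i _; rewrite sqr_ge0. Qed.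

Lemma l2norm_eq0 {R : realType} {n} (z : 'cV[R]_n) : l2norm z = 0 -> z = 0.
Proof.
move=> z0; have := sqr_l2norm z; rewrite z0 expr0n /= => /esym/eqP.
rewrite psumr_eq0 => [|i _]; last exact: sqr_ge0.
move=> /allP H; apply/matrixP => i j; rewrite (ord1 j) mxE.
by apply/eqP; rewrite -sqrf_eq0; apply: H; rewrite mem_index_enum.
Qed.

Lemma sum_mul_le_l2norm {R : realType} {n} (u v : 'cV[R]_n) :
  \sum_i u i 0 * v i 0 <= l2norm u * l2norm v.
Proof.
have [/l2norm_eq0->|u0] := eqVneq (l2norm u) 0.
  rewrite big1 => [|i _]; last by rewrite mxE mul0r.
  by rewrite mulr_ge0 ?l2norm_ge0.
have [/l2norm_eq0->|v0] := eqVneq (l2norm v) 0.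
  rewrite big1 => [|i _]; last by rewrite mxE mulr0.
  by rewrite mulr_ge0 ?l2norm_ge0.
have {}u0 : 0 < l2norm u by rewrite lt0r u0 l2norm_ge0.
have {}v0 : 0 < l2norm v by rewrite lt0r v0 l2norm_ge0.
set a := l2norm u in u0 *; set b := l2norm v in v0 *.
(* AM-GM termwise, with the weights that make both sums equal. *)
have amgm i : u i 0 * v i 0 <= b / (2 * a) * u i 0 ^+ 2 + a / (2 * b) * v i 0 ^+ 2.
  rewrite -subr_ge0.
  have -> : b / (2 * a) * u i 0 ^+ 2 + a / (2 * b) * v i 0 ^+ 2 - u i 0 * v i 0 =
      (b * u i 0 - a * v i 0) ^+ 2 / (2 * a * b).
    by field; rewrite !gt_eqF.
  by rewrite divr_ge0 ?sqr_ge0// !mulr_ge0// ltW.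
apply: le_trans (ler_sum _ (fun i _ => amgm i)) _.
rewrite big_split/= -!mulr_sumr -!sqr_l2norm -/a -/b le_eqVlt; apply/orP; left.
by apply/eqP; field; rewrite !gt_eqF.
Qed.

Lemma l2normD {R : realType} {n} (u v : 'cV[R]_n) :
  l2norm (u + v) <= l2norm u + l2norm v.
Proof.
rewrite -ler_sqr ?nnegrE ?addr_ge0 ?l2norm_ge0// sqr_l2norm sqrrD !sqr_l2norm.
under eq_bigr do rewrite mxE sqrrD.
rewrite big_split big_split lerD2r lerD2l sumrMnl ler_pMn2r//.
exact: sum_mul_le_l2norm.
Qed.

Lemma l2normN {R : realType} {n} (u : 'cV[R]_n) : l2norm (- u) = l2norm u.
Proof. by rewrite /l2norm; under eq_bigr do rewrite mxE sqrrN. Qed.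

Lemma sqr_l2norm_restrictT {R : realType} {n} (z : 'cV[R]_n) (S : {set 'I_n}) :
  l2norm (restrictT z S) ^+ 2 = \sum_(i in S) z i 0 ^+ 2.
Proof.
rewrite sqr_l2norm [RHS]big_mkcond/=; apply: eq_bigr => i _; rewrite mxE.
by case: ifP => // _; rewrite expr0n.
Qed.

Lemma sparse_restrictT {R : realType} {n} (z : 'cV[R]_n) (S : {set 'I_n}) s :
  (#|S| <= s)%N -> sparse s (restrictT z S).
Proof.
move=> Ss; apply: leq_trans Ss; apply/subset_leq_card/fintype.subsetP => i.
by rewrite inE mxE; case: ifP => //; rewrite eqxx.
Qed.

Lemma restrictT_setC {R : realType} {n} (z : 'cV[R]_n) (S : {set 'I_n}) :
  restrictT z S = z - restrictT z (~: S).
Proof.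
apply/matrixP => i j; rewrite (ord1 j) !mxE inE.
by case: (i \in S); rewrite /= ?subr0 ?subrr.
Qed.

(** * Largest entries and sums over index sets *)

(** Greedy selection: a maximiser over the remaining indices is added at each step. The ambient set
    [U] allows a second block to be drawn from the complement of the first. *)
Lemma exists_top_subset {R : realType} {T : finType} (f : T -> R) (U : {set T}) j :
  (j <= #|U|)%N -> exists2 S : {set T}, S \subset U & #|S| = j /\
    forall i i', i \in S -> i' \in U :\: S -> f i' <= f i.
Proof.
elim: j => [|j IH] jU.
  by exists finset.set0; rewrite ?finset.sub0set// cards0; split=> // i i'; rewrite inE.
have [S SU [Sj Stop]] := IH (ltnW jU).
have /card_gt0P[i0 i0D] : (0 < #|U :\: S|)%N.
  by rewrite cardsD (finset.setIidPr SU) Sj subn_gt0.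
case: (@arg_maxP _ _ _ i0 (mem (U :\: S)) f i0D) => c cD cmax.
have /finset.setDP[cU cS] := cD.
exists (c |: S); first by rewrite finset.subUset finset.sub1set cU.
split=> [|i i']; first by rewrite cardsU1 cS Sj.
rewrite !inE negb_or -andbA => /orP[/eqP->|iS] /and3P[i'c i'S i'U].
  by apply: cmax; apply/finset.setDP.
by apply: Stop => //; rewrite inE i'S.
Qed.

(** After cancelling the common indices, the largest value on [V :\: S] bounds every term there from
    above and every term on [S :\: V] from below. *)
Lemma sum_le_top {R : realType} {T : finType} (F : T -> R) (S V : {set T}) :
    (forall i, 0 <= F i) -> (#|V| <= #|S|)%N ->
    (forall i i', i \in S -> i' \notin S -> F i' <= F i) ->
  \sum_(i in V) F i <= \sum_(i in S) F i.
Proof.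
move=> F0 VS top.
rewrite (big_setID S) [leRHS](big_setID V)/= finset.setIC lerD2l.
have DD : (#|V :\: S| <= #|S :\: V|)%N.
  by rewrite !cardsD finset.setIC leq_sub2r.
have [->|[i0 i0D]] := set_0Vmem (V :\: S).
  by rewrite big_set0 sumr_ge0.
case: (@arg_maxP _ _ _ i0 (mem (V :\: S)) F i0D) => c cD cmax.
have /finset.setDP[_ cS] := cD.
apply: (@le_trans _ _ (F c *+ #|V :\: S|)).
  by rewrite -sumr_const; apply: ler_sum => i iD; exact: cmax.
apply: (@le_trans _ _ (F c *+ #|S :\: V|)); first exact: ler_wpMn2l.
by rewrite -sumr_const; apply: ler_sum => i /finset.setDP[iS _]; exact: top.
Qed.

(** Jensen's inequality for the concave power [q], obtained from its tangent line at the mean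
    [m]. *)
Lemma sum_powR_le {R : realType} {T : finType} (q : R) (z : T -> R) (S : {set T}) :
    0 < q < 1 -> (0 < #|S|)%N -> (forall i, 0 <= z i) ->
  #|S|%:R `^ (q - 1) * (\sum_(i in S) z i `^ q) <= (\sum_(i in S) z i) `^ q.
Proof.
move=> q01 S0 z0; have /andP[q0 q1] := q01.
have k0 : 0 < #|S|%:R :> R by rewrite ltr0n.
set B := \sum_(i in S) z i; have B0 : 0 <= B by rewrite sumr_ge0.
have [Beq|Bn] := eqVneq B 0.
  rewrite big1 ?mulr0 ?powR_ge0// => i iS.
  suff -> : z i = 0 by rewrite powR0// gt_eqF.
  have /eqP := Beq; rewrite psumr_eq0// => /allP /(_ i).
  by rewrite mem_index_enum iS => /(_ isT)/eqP.
have Bp : 0 < B by rewrite lt0r Bn.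
set m := B / #|S|%:R; have m0 : 0 < m by rewrite divr_gt0.
have -> : \sum_(i in S) z i `^ q = m `^ q * \sum_(i in S) (z i / m) `^ q.
  rewrite mulr_sumr; apply: eq_bigr => i _.
  by rewrite -powRM ?divr_ge0 ?(ltW m0)// mulrCA divff ?gt_eqF// mulr1.
have H : \sum_(i in S) (z i / m) `^ q <= #|S|%:R.
  apply: (@le_trans _ _ (\sum_(i in S) (1 + q * (z i / m - 1)))).
    by apply: ler_sum => i _; apply: powR_le_tangent => //; rewrite divr_ge0 ?(ltW m0).
  rewrite big_split/= sumr_const -mulr_sumr big_split/= -mulr_suml sumr_const -/B.
  (* The deviations from the mean sum to zero, so the linear terms disappear. *)
  suff -> : B / m + -1 *+ #|S| = 0 by rewrite mulr0 addr0.
  by rewrite /m invf_div mulrCA divff// mulr1 mulNrn subrr.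
apply: (@le_trans _ _ (#|S|%:R `^ (q - 1) * (m `^ q * #|S|%:R))).
  by rewrite !ler_wpM2l ?powR_ge0.
have -> : B = #|S|%:R * m by rewrite mulrC divfK ?gt_eqF.
rewrite powRM ?(ltW k0) ?(ltW m0)// -[in leRHS](mulr_powRB1 (ltW k0) q0) le_eqVlt.
by apply/orP; left; apply/eqP; move: (_ `^ _) (m `^ q) => X Y; ring.
Qed.

(** * Block estimates from the restricted isometry property *)

(** The scalar core: [a2], [c2] and [b2] stand for the squared l2-norms of the k largest, the 2k
    largest and the 2k smallest entries, and [W] for the scaled p-th power sum outside the first
    block. Division by [kap] reduces the first bound to [head_powR_le]. *)
Lemma block_powR_bounds {R : realType} (d p eta kap u a2 b2 c2 W : R) :
    0 < p < 1 -> Num.sqrt 2 / 2 <= d < 1 -> 0 <= eta -> 0 < kap -> 0 <= u ->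
    kap ^+ 2 <= a2 -> 0 <= b2 <= kap ^+ 2 * u -> a2 + kap ^+ 2 <= c2 ->
    Num.sqrt c2 <= eta + Num.sqrt ((1 + d) / (1 - d) * b2) ->
    kap `^ p * (1 + u) <= W ->
  a2 `^ (p / 2) <= Cbar d p * W + 2 * eta `^ p /\
  (c2 + b2) `^ (p / 2) <= Dbar d p * W + eta `^ p.
Proof.
move=> p01 d01 eta0 k0 u0 ka /andP[b0 bk] ac cb kW.
have /andP[p0 p1] := p01; have /andP[d0 d1] := d01.
have s0 : 0 <= Num.sqrt 2 :> R := sqrtr_ge0 _.
have dp : 0 <= d by lra.
have e0 : 0 < 1 - d by lra.
have kk0 : 0 < kap ^+ 2 by rewrite exprn_gt0.
have a0 : 0 <= a2 by lra.
have c0 : 0 <= c2 by lra.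
have C0 : 0 <= Cbar d p.
  by rewrite CbarE// mulr_ge0 ?Dbar_ge0//; lra.
have kE : kap = Num.sqrt (kap ^+ 2) by rewrite sqrtr_sqr gtr0_norm.
set M := (1 + d) / (1 - d) in cb *.
have M0 : 0 <= M by rewrite divr_ge0//; lra.
have Mu0 : 0 <= M * u by rewrite mulr_ge0.
have Mb0 : 0 <= M * b2 by rewrite mulr_ge0.
have half x : 0 <= x -> x `^ (p / 2) = Num.sqrt x `^ p.
  by move=> x0; rewrite mulrC powRrM powR12_sqrt.
split.
  have H := head_powR_le d p (Num.sqrt a2 / kap) u (eta / kap) p01 d01.
  have {H} : (Num.sqrt a2 / kap) `^ p <= Cbar d p * (1 + u) + 2 * (eta / kap) `^ p.
    apply: H => //.
    - by rewrite ler_pdivlMr// mul1r {1}kE ler_sqrt.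
    - by rewrite divr_ge0// ltW.
    rewrite -/M -(ler_pM2l kk0) mulrDr mulr1 -!exprMn mulrDr.
    rewrite !(mulrC kap) !divfK ?gt_eqF// sqr_sqrtr//.
    apply: (le_trans ac); rewrite -[leLHS]sqr_sqrtr// ler_sqr ?nnegrE ?sqrtr_ge0//;
      last by rewrite addr_ge0// mulr_ge0 ?sqrtr_ge0// ltW.
    apply: (le_trans cb); rewrite lerD2l [X in _ <= _ * X]kE -sqrtrM//.
    rewrite ler_sqrt ?(mulr_ge0 Mu0 (ltW kk0))//.
    by have := ler_wpM2l M0 bk; rewrite mulrCA (mulrC (kap ^+ 2)).
  have kp0 : 0 < kap `^ p by rewrite powR_gt0.
  move/(ler_wpM2l (ltW kp0)); rewrite -powRM ?divr_ge0 ?sqrtr_ge0 ?(ltW k0)//.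
  rewrite (mulrC kap) divfK ?gt_eqF// -half// => /le_trans; apply.
  rewrite mulrDr mulrCA; apply: lerD; first exact: ler_wpM2l.
  rewrite mulrCA -powRM ?divr_ge0 ?(ltW k0)//.
  by rewrite (mulrC kap) divfK ?gt_eqF.
have N0 : 0 <= 2 / (1 - d) by rewrite divr_ge0// ltW.
have NE : 2 / (1 - d) = M + 1 by rewrite /M; field; rewrite gt_eqF.
have Nb0 : 0 <= 2 / (1 - d) * b2 by rewrite mulr_ge0.
(* Adding [b2] to the squared bound on [c2] turns [M * b2] into [(M + 1) * b2]; replacing [M] by
   [M + 1] in the cross term only enlarges it. *)
have H : Num.sqrt (c2 + b2) <= Num.sqrt (2 / (1 - d) * b2) + eta.
  rewrite -ler_sqr ?nnegrE ?addr_ge0 ?sqrtr_ge0// sqr_sqrtr ?addr_ge0//.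
  have : Num.sqrt c2 ^+ 2 <= (eta + Num.sqrt (M * b2)) ^+ 2.
    by rewrite ler_sqr ?nnegrE ?addr_ge0 ?sqrtr_ge0.
  rewrite !sqrrD !sqr_sqrtr//.
  have : eta * Num.sqrt (M * b2) <= Num.sqrt (2 / (1 - d) * b2) * eta.
    by rewrite mulrC ler_wpM2r// ler_sqrt// ler_wpM2r// NE; lra.
  rewrite NE; lra.
have p2 : 0 <= p / 2 by lra.
rewrite half ?addr_ge0//.
apply: (@le_trans _ _ ((Num.sqrt (2 / (1 - d) * b2) + eta) `^ p)).
  by apply: ge0_ler_powR => //; rewrite ?nnegrE ?addr_ge0 ?sqrtr_ge0// ltW.
apply: le_trans (powR_subadditive _ _ _ _ _ _) _ => //; rewrite ?sqrtr_ge0//.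
  by rewrite p0 ltW.
rewrite lerD2r -half//.
apply: (@le_trans _ _ ((2 / (1 - d) * (kap ^+ 2 * u)) `^ (p / 2))).
  apply: ge0_ler_powR => //; last exact: ler_wpM2l.
  by rewrite nnegrE (mulr_ge0 N0)// mulr_ge0// ltW.
rewrite (powRM _ N0 (mulr_ge0 (ltW kk0) u0)) (powRM _ (ltW kk0) u0).
rewrite (half _ (ltW kk0)) -kE.
apply: (@le_trans _ _ ((2 / (1 - d)) `^ (p / 2) *
   (kap `^ p * (gfun p `^ (p / 2) * (1 + u))))).
  by do 2!rewrite ler_wpM2l ?powR_ge0//; exact: powR_half_tail.
have DE : Dbar d p = (2 / (1 - d)) `^ (p / 2) * gfun p `^ (p / 2).
  by rewrite -powRM ?gfun_ge0// mulrAC.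
rewrite (mulrCA (kap `^ p)) DE -(mulrA _ (gfun p `^ _)).
by do 2!(apply: ler_wpM2l; first exact: powR_ge0).
Qed.

Lemma sum_setU_disjoint {R : realType} {T : finType} (F : T -> R) (S V : {set T}) :
  [disjoint S & V] ->
  \sum_(i in S :|: V) F i = \sum_(i in S) F i + \sum_(i in V) F i.
Proof. by move=> SV; rewrite -bigU//=; apply: eq_bigl => i; rewrite !inE. Qed.

Lemma sum_setC {R : realType} {T : finType} (F : T -> R) (S : {set T}) :
  \sum_i F i = \sum_(i in S) F i + \sum_(i in ~: S) F i.
Proof.
rewrite (bigID (mem S))/=; congr (_ + _).
by apply: eq_bigl => i; rewrite finset.in_setC.
Qed.

(** The lower isometry bound is applied to the part of [h] on [S], the upper one to the part off
    [S], and the triangle inequality joins them, the image of the first part being [A *m h] minus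
    that of the second. *)
Lemma RIP_head_le {R : realType} {m n} (A : 'M[R]_(m, n)) s d (h : 'cV[R]_n)
    (S : {set 'I_n}) r :
    RIP_bound A s d -> -1 <= d < 1 -> (#|S| <= s)%N -> (#|~: S| <= s)%N ->
    l2norm (A *m h) <= r ->
  Num.sqrt (\sum_(i in S) h i 0 ^+ 2) <= r / Num.sqrt (1 - d) +
    Num.sqrt ((1 + d) / (1 - d) * \sum_(i in ~: S) h i 0 ^+ 2).
Proof.
move=> rip /andP[d0 d1] Ss CSs Ahr.
have e0 : 0 < 1 - d by lra.
have q0 : 0 < Num.sqrt (1 - d) by rewrite sqrtr_gt0.
have f0 : 0 <= 1 + d by lra.
have [lo _] := rip _ (sparse_restrictT h S s Ss).
have [_ up] := rip _ (sparse_restrictT h (~: S) s CSs).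
rewrite sqr_l2norm_restrictT in lo; rewrite (sqr_l2norm_restrictT h) in up.
set a := \sum_(i in S) _ in lo *; set b := \sum_(i in ~: S) _ in up *.
have b0 : 0 <= b by apply: sumr_ge0 => i _; rewrite sqr_ge0.
have {}lo : Num.sqrt (1 - d) * Num.sqrt a <= l2norm (A *m restrictT h S).
  rewrite -sqrtrM ?(ltW e0)// -[leRHS](ger0_norm (l2norm_ge0 _)) -sqrtr_sqr.
  by rewrite ler_sqrt ?sqr_ge0.
have {}up : l2norm (A *m restrictT h (~: S)) <= Num.sqrt (1 - d) *
    Num.sqrt ((1 + d) / (1 - d) * b).
  rewrite -sqrtrM ?(ltW e0)// mulrA mulrCA divff ?gt_eqF// mulr1.
  rewrite -[leLHS](ger0_norm (l2norm_ge0 _)) -sqrtr_sqr ler_sqrt//.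
  exact: mulr_ge0.
rewrite -(ler_pM2l q0) mulrDr (mulrC _ (r / _)) divfK ?gt_eqF//.
apply: (le_trans lo); rewrite restrictT_setC mulmxBr.
apply: (le_trans (l2normD _ _)); rewrite l2normN.
exact: lerD.
Qed.

Lemma powR_sqr_half {R : realType} (p x : R) : (x ^+ 2) `^ (p / 2) = `|x| `^ p.
Proof. by rewrite mulrC powRrM powR12_sqrt ?sqr_ge0// sqrtr_sqr. Qed.

Lemma RIP_block_bounds {R : realType} {k m n} (A : 'M[R]_(m, n)) d p (h : 'cV[R]_n) r :
    (0 < k)%N -> n = (4 * k)%N -> RIP_bound A (2 * k) d ->
    Num.sqrt 2 / 2 <= d < 1 -> 0 < p < 1 -> l2norm (A *m h) <= r ->
  exists S : {set 'I_n}, [/\ #|S| = k,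
    forall i i', i \in S -> i' \notin S -> `|h i' 0| <= `|h i 0|,
    k%:R `^ (p / 2 - 1) * (\sum_(i in S) `|h i 0| `^ p) <=
      Cbar d p * (k%:R `^ (p / 2 - 1) * \sum_(i in ~: S) `|h i 0| `^ p) +
      2 * (r / Num.sqrt (1 - d)) `^ p &
    l2norm h `^ p <=
      Dbar d p * (k%:R `^ (p / 2 - 1) * \sum_(i in ~: S) `|h i 0| `^ p) +
      (r / Num.sqrt (1 - d)) `^ p].
Proof.
move=> k0 nE rip d01 p01 Ahr.
have /andP[p0 p1] := p01; have /andP[d0 d1] := d01.
have kR : 0 < k%:R :> R by rewrite ltr0n.
have s0 : 0 <= Num.sqrt 2 :> R := sqrtr_ge0 _.
have e0 : 0 < Num.sqrt (1 - d) by rewrite sqrtr_gt0; lra.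
set f := fun i => `|h i 0|.
have kT : (k <= #|[set: 'I_n]|)%N by rewrite cardsT card_ord nE leq_pmull.
have [S0 _ [S0k top0]] := exists_top_subset f [set: 'I_n] k kT.
have {}top0 i i' : i \in S0 -> i' \notin S0 -> f i' <= f i.
  by move=> iS iS'; apply: top0 => //; rewrite !inE iS'.
have kC : (k <= #|~: S0|)%N by 
  by rewrite cardsCs finset.setCK S0k card_ord nE -{3}(mul1n k) -mulnBl leq_pmull.
have [S1 S1C [S1k top1]] := exists_top_subset f (~: S0) k kC.
have [j0 j0S1] : exists j, j \in S1 by apply/card_gt0P; rewrite S1k.
(* The threshold [t] is a lower bound for the entries of both blocks and an upper bound for all the
   others. *)
case: (@arg_minP _ _ _ j0 (mem S1) f j0S1) => c cS1 cmin.
set t := f c in cmin.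
have t0 : 0 <= t := normr_ge0 _.
have S10 i : i \in S1 -> i \notin S0.
  by move=> /(fintype.subsetP S1C); rewrite inE.
have dis : [disjoint S0 & S1].
  by rewrite disjoint_sym finset.disjoints_subset.
set S := S0 :|: S1.
have t_le0 i : i \in S0 -> t <= f i by move=> iS; apply: top0 => //; exact: S10.
have t_ge i : i \in ~: S -> f i <= t.
  rewrite !inE negb_or => /andP[i0 i1]; apply: top1 => //.
  by rewrite !inE i0 i1.
have SS : #|S| = (2 * k)%N.
  by rewrite cardsU disjoint_setI0// cards0 S0k S1k subn0 mul2n addnn.
have CS : #|~: S| = (2 * k)%N by 
  by rewrite cardsCs finset.setCK SS card_ord nE -mulnBl.
have d1' : -1 <= d < 1 by rewrite d1 andbT; lra.
have := RIP_head_le A (2 * k) d h S r rip d1'.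
rewrite SS CS => /(_ (leqnn _) (leqnn _) Ahr).
set eta := r / _.
have eta0 : 0 <= eta by rewrite divr_ge0 ?sqrtr_ge0// (le_trans _ Ahr) ?l2norm_ge0.
set c2 := \sum_(i in S) _; set b2 := \sum_(i in ~: S) _ => cb.
set a2 := \sum_(i in S0) h i 0 ^+ 2.
set a1 := \sum_(i in S1) h i 0 ^+ 2.
have c2E : c2 = a2 + a1 by exact: sum_setU_disjoint.
have a20 : 0 <= a2 by rewrite sumr_ge0// => i _; rewrite sqr_ge0.
have a10 : 0 <= a1 by rewrite sumr_ge0// => i _; rewrite sqr_ge0.
have b20 : 0 <= b2 by rewrite sumr_ge0// => i _; rewrite sqr_ge0.
have hE : l2norm h ^+ 2 = c2 + b2.
  by rewrite sqr_l2norm (sum_setC _ S).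
set Q := \sum_(i in ~: S0) `|h i 0| `^ p.
set P2 := \sum_(i in ~: S) `|h i 0| `^ p.
have P20 : 0 <= P2 by rewrite sumr_ge0// => i _; rewrite powR_ge0.
have CS0 : ~: S0 = S1 :|: ~: S.
  apply/finset.setP => i; rewrite !inE; case: (boolP (i \in S1)) => [/S10 ->|] //=.
  by rewrite orbF.
have QE : Q = \sum_(i in S1) `|h i 0| `^ p + P2.
  rewrite /Q CS0 sum_setU_disjoint//.
  by rewrite finset.disjoints_subset finset.setCK finset.subsetUr.
have sqf i : h i 0 ^+ 2 = f i ^+ 2 by rewrite /f real_normK ?num_real.
have fp0 i : 0 <= f i := normr_ge0 _.
have constS (T : {set 'I_n}) (x : R) : #|T| = k -> \sum_(i in T) x = k%:R * x.
  by move=> Tk; rewrite sumr_const Tk mulr_natl.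
(* Jensen with exponent [p / 2], applied to the squared entries. *)
have hp : k%:R `^ (p / 2 - 1) * (\sum_(i in S0) `|h i 0| `^ p) <= a2 `^ (p / 2).
  have q01 : 0 < p / 2 < 1 by apply/andP; split; lra.
  have := sum_powR_le (p / 2) (fun i => h i 0 ^+ 2) S0 q01.
  rewrite S0k => /(_ k0 (fun i => sqr_ge0 _)).
  by under eq_bigr do rewrite powR_sqr_half.
set W := k%:R `^ (p / 2 - 1) * Q.
suff [H1 H2] : a2 `^ (p / 2) <= Cbar d p * W + 2 * eta `^ p /\
  (c2 + b2) `^ (p / 2) <= Dbar d p * W + eta `^ p.
  exists S0; split=> //; first exact: le_trans hp H1.
  by move: H2; rewrite -hE powR_sqr_half ger0_norm ?l2norm_ge0.
(* For [t = 0] normalising is impossible, but then [h] vanishes off [S], so [b2 = 0] and the noise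
   alone bounds [c2]. *)
have [tpos|] := ltP 0 t; last first.
  move=> tle; have tz : t = 0 by apply/eqP; rewrite eq_le tle t0.
  have b2z : b2 = 0.
    apply: big1 => i /t_ge; rewrite tz sqf => fi.
    have -> : f i = 0 by apply/eqP; rewrite eq_le fi fp0.
    by rewrite expr0n.
  have W0 : 0 <= W.
    by rewrite mulr_ge0 ?powR_ge0// sumr_ge0// => i _; rewrite powR_ge0.
  have C0 : 0 <= Cbar d p by rewrite CbarE// mulr_ge0 ?Dbar_ge0//; lra.
  have CW := mulr_ge0 C0 W0.
  have DW := mulr_ge0 (Dbar_ge0 d p) W0.
  have ceta : c2 <= eta ^+ 2.
    move: cb; rewrite b2z mulr0 sqrtr0 addr0 => cb.
    have c0 : 0 <= c2 by rewrite c2E addr_ge0.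
    by rewrite -(sqr_sqrtr c0) ler_sqr ?nnegrE ?sqrtr_ge0.
  have etaE : eta `^ p = (eta ^+ 2) `^ (p / 2).
    by rewrite powR_sqr_half ger0_norm.
  have p2 : 0 <= p / 2 by lra.
  have mono x : 0 <= x -> x <= eta ^+ 2 -> x `^ (p / 2) <= eta `^ p.
    by move=> x0 xe; rewrite etaE ge0_ler_powR ?nnegrE ?sqr_ge0.
  have e0p := powR_ge0 eta p.
  have H1 := mono a2 a20; have H2 := mono (c2 + b2).
  split; first by have := H1 _; lra.
  by have := H2 _ _; rewrite b2z addr0 c2E addr_ge0// => /(_ isT); rewrite -c2E; lra.
have tp0 : 0 < t `^ p by rewrite powR_gt0.
set kap := t * Num.sqrt k%:R.
have kap0 : 0 < kap by rewrite mulr_gt0// sqrtr_gt0.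
have kap2 : kap ^+ 2 = k%:R * t ^+ 2 by rewrite exprMn sqr_sqrtr ?ltW// mulrC.
have kapp : kap `^ p = k%:R `^ (p / 2 - 1) * (k%:R * t `^ p).
  rewrite /kap powRM ?sqrtr_ge0// -powR12_sqrt ?(ltW kR)// -powRrM (mulrC 2^-1).
  have p2 : 0 < p / 2 by lra.
  by rewrite -(mulr_powRB1 (ltW kR) p2) mulrC mulrCA mulrA.
have ktp : 0 < k%:R * t `^ p by rewrite mulr_gt0.
apply: (block_powR_bounds d p eta kap (P2 / (k%:R * t `^ p)) a2 b2 c2 W) => //.
- by rewrite divr_ge0 ?(ltW ktp).
- rewrite kap2 -(constS S0)// ler_sum// => i /t_le0 ti.
  by rewrite sqf ler_sqr ?nnegrE.
- rewrite b20/= kap2 /b2.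
  (* Each tail entry is at most [t], so its square is at most the power [2 - p] of [t] times the
     [p]-th power of the entry; summing gives exactly [kap ^+ 2 * u]. *)
  have -> : k%:R * t ^+ 2 * (P2 / (k%:R * t `^ p)) = t `^ (2 - p) * P2.
    rewrite powRB; last by rewrite (gt_eqF tpos) implybT.
    rewrite (powR_mulrn 2)//; field.
    by rewrite !gt_eqF.
  rewrite /P2 mulr_sumr ler_sum// => i /t_ge it.
  have [fz|fn] := eqVneq (f i) 0.
    by rewrite sqf fz expr0n/= mulr_ge0 ?powR_ge0.
  have -> : h i 0 ^+ 2 = f i `^ (2 - p) * f i `^ p.
    rewrite -powRD; last by rewrite fn implybT.
    by rewrite subrK sqf powR_mulrn.
  rewrite ler_wpM2r ?powR_ge0// ge0_ler_powR ?nnegrE//; lra.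
- rewrite c2E lerD2l kap2 -(constS S1)// ler_sum// => i iS.
  by rewrite sqf ler_sqr ?nnegrE//; exact: cmin.
(* Multiplying out 1 + u leaves [P2] plus k copies of the [p]-th power of [t]; the copies are
   dominated by the second block, which completes [P2] to [Q]. *)
rewrite kapp /W -mulrA ler_wpM2l ?powR_ge0// QE mulrDr mulr1.
rewrite (mulrC _ (P2 / _)) divfK ?gt_eqF// lerD2r -(constS S1)// ler_sum// => i iS.
by rewrite ge0_ler_powR ?nnegrE ?(ltW p0)//; exact: cmin.
Qed.

(** * Consequences of lp-minimality *)

Lemma powR_lpnorm {R : realType} {n} (p : R) (z : 'cV[R]_n) : 0 < p ->
  lpnorm p z `^ p = \sum_i `|z i 0| `^ p.
Proof.
move=> p0; rewrite /lpnorm -powRrM mul1r mulVf ?gt_eqF// powRr1//.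
by apply: sumr_ge0 => i _; rewrite powR_ge0.
Qed.

Lemma powR_lpnorm_restrictT {R : realType} {n} (p : R) (z : 'cV[R]_n)
    (T : {set 'I_n}) :
  0 < p -> lpnorm p (restrictT z T) `^ p = \sum_(i in T) `|z i 0| `^ p.
Proof.
move=> p0; rewrite powR_lpnorm// [RHS]big_mkcond/=; apply: eq_bigr => i _.
by rewrite mxE; case: ifP => // _; rewrite normr0 powR0 ?gt_eqF.
Qed.

Lemma sum_powR_le_of_lpnorm {R : realType} {n} (p : R) (z x : 'cV[R]_n) : 0 < p ->
  lpnorm p z <= lpnorm p x -> \sum_i `|z i 0| `^ p <= \sum_i `|x i 0| `^ p.
Proof.
move=> p0; apply: contraTT; rewrite -!ltNge => xz.
apply: gt0_ltr_powR => //; first by rewrite divr_gt0.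
all: by rewrite nnegrE sumr_ge0// => i _; rewrite powR_ge0.
Qed.

(** Subadditivity bounds [x] by [z] and [x - z] on [T], and [x - z] by [x] and [z] off [T];
    comparing the total power sums then eliminates [z]. *)
Lemma lp_minimizer_cone {R : realType} {n} (p : R) (x z : 'cV[R]_n) (T : {set 'I_n}) :
    0 < p < 1 -> lpnorm p z <= lpnorm p x ->
  \sum_(i in ~: T) `|(x - z) i 0| `^ p <=
    \sum_(i in T) `|(x - z) i 0| `^ p + 2 * \sum_(i in ~: T) `|x i 0| `^ p.
Proof.
move=> /andP[p0 p1] zx.
have p01 : 0 < p <= 1 by rewrite p0 ltW.
have sub (a b : R) : `|a + b| `^ p <= `|a| `^ p + `|b| `^ p.
  apply: le_trans (powR_subadditive _ _ _ p01 _ _) => //.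
  by apply: ge0_ler_powR; rewrite ?nnegrE ?addr_ge0 ?ler_normD// ltW.
have H0 := sum_powR_le_of_lpnorm p z x p0 zx.
rewrite (sum_setC _ T) [leRHS](sum_setC _ T) in H0.
have H1 : \sum_(i in T) `|x i 0| `^ p <=
    \sum_(i in T) `|z i 0| `^ p + \sum_(i in T) `|(x - z) i 0| `^ p.
  rewrite -big_split/= ler_sum// => i _; apply: le_trans (sub _ _).
  by rewrite !mxE subrKC.
have H2 : \sum_(i in ~: T) `|(x - z) i 0| `^ p <=
    \sum_(i in ~: T) `|x i 0| `^ p + \sum_(i in ~: T) `|z i 0| `^ p.
  rewrite -big_split/= ler_sum// => i _; rewrite !mxE.
  by apply: le_trans (sub _ _) _; rewrite normrN.
move: H0 H1 H2; clear.
move: (\sum_(i in T) `|x i 0| `^ p) (\sum_(i in ~: T) `|x i 0| `^ p) => x1 x2.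
move: (\sum_(i in T) `|z i 0| `^ p) (\sum_(i in ~: T) `|z i 0| `^ p) => z1 z2.
by move: (\sum_(i in T) _) (\sum_(i in ~: T) _) => h1 h2; lra.
Qed.

(** * The recovery bound *)

(** The set [T] is arbitrary because two choices are needed: the first k indices for the error
    bound, the support of [x] for exact recovery. *)
Lemma lp_recovery {R : realType} {k m n} (A : 'M[R]_(m, n)) d p eps
    (x z : 'cV[R]_n) (T : {set 'I_n}) :
    (0 < k)%N -> n = (4 * k)%N -> RIP_bound A (2 * k) d ->
    Num.sqrt 2 / 2 <= d < 1 -> 0 < p < 1 -> Cbar d p < 1 ->
    0 <= eps -> l2norm (A *m (x - z)) <= 2 * eps -> lpnorm p z <= lpnorm p x ->
    (#|T| <= k)%N ->
  l2norm (x - z) `^ p <=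
    2 * Dbar d p / (1 - Cbar d p) * k%:R `^ (p / 2 - 1) *
      lpnorm p (restrictT x (~: T)) `^ p +
    2 `^ p / (1 - d) `^ (p / 2) * (1 + 2 * Dbar d p / (1 - Cbar d p)) * eps `^ p.
Proof.
move=> k0 nE rip d01 p01 C1 eps0 Ah zx Tk.
have /andP[p0 p1] := p01; have /andP[_ d1] := d01.
have [S [Sk top headS normS]] :=
  RIP_block_bounds A d p (x - z) _ k0 nE rip d01 p01 Ah.
have cone := lp_minimizer_cone p x z T p01 zx.
rewrite powR_lpnorm_restrictT//.
have EE : (2 * eps / Num.sqrt (1 - d)) `^ p = 2 `^ p / (1 - d) `^ (p / 2) * eps `^ p.
  have e0 : 0 <= 1 - d by rewrite subr_ge0 ltW.
  have sE : Num.sqrt (1 - d) `^ p = (1 - d) `^ (p / 2).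
    by rewrite -(powR12_sqrt e0) -powRrM (mulrC p).
  have te0 : 0 <= 2 * eps by rewrite mulr_ge0.
  have iq0 : 0 <= (Num.sqrt (1 - d))^-1 by rewrite invr_ge0 sqrtr_ge0.
  rewrite (powRM _ te0 iq0) (powRM _ _ eps0)//.
  by rewrite -(powR_inv1 (sqrtr_ge0 (1 - d))) powRAC sE powR_inv1 ?powR_ge0//
    mulrAC.
rewrite EE in headS normS; set E := _ / _ * _ in headS normS.
set sig := \sum_(i in ~: T) `|x i 0| `^ p in cone *.
set w := fun i => `|(x - z) i 0| `^ p in cone *.
have topw : \sum_(i in T) w i <= \sum_(i in S) w i.
  apply: sum_le_top => [i||i i' iS iS']; rewrite ?Sk ?powR_ge0//.
  by rewrite ge0_ler_powR ?nnegrE ?(ltW p0)//; exact: top.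
(* Passing from [T] to [S] raises the sum inside the set and, the total being fixed, lowers the sum
   outside. *)
have {}cone : \sum_(i in ~: S) w i <= \sum_(i in S) w i + 2 * sig.
  have := sum_setC w T; rewrite (sum_setC w S); move: cone topw; clear.
  move: sig (\sum_(i in T) w i) (\sum_(i in ~: T) w i) => sig a b.
  move: (\sum_(i in S) w i) (\sum_(i in ~: S) w i) => a' b'; lra.
set K := k%:R `^ (p / 2 - 1) in headS normS *.
have K0 : 0 <= K := powR_ge0 _ _.
have {}cone := ler_wpM2l K0 cone; rewrite mulrDr (mulrCA K 2) in cone.
have c0 : 0 < 1 - Cbar d p by rewrite subr_gt0.
(* The head is at most C(p) times the tail plus noise, and the tail at most the head plus [2 * sig].
   Since C(p) < 1, the tail can be solved for. *)
have W1 : K * (\sum_(i in ~: S) w i) <= (2 * (K * sig) + 2 * E) / (1 - Cbar d p).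
  rewrite ler_pdivlMr//; move: headS cone; clear; move: (K * sig) E => s e.
  by move: (K * _) (K * _) => a b; lra.
have := ler_wpM2l (Dbar_ge0 d p) W1 => {}W1.
apply: (le_trans normS); apply: (@le_trans _ _ (_ + E)); first by rewrite lerD2r; exact: W1.
rewrite le_eqVlt; apply/orP; left; apply/eqP; rewrite /E.
by move: (_ / _ `^ _) (eps `^ _) => X Y; field; rewrite gt_eqF.
Qed.

Theorem theorem4 (R : realType) (k m n : nat) (hk : (0 < k)%N) (hm : (0 < m)%N)
  (hn : n = (4 * k)%N) (A : 'M[R]_(m, n)) (delta : R)
  (hric : is_RIC A (2 * k) delta)
  (hdl : Num.sqrt 2 / 2 <= delta) (hdu : delta < 1)
  (x : 'cV[R]_n) (eps : R) (heps : 0 <= eps) (e : 'cV[R]_m)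
  (he : l2norm e <= eps) (y : 'cV[R]_m) (hy : y = A *m x + e)
  (p : R) (hp0 : 0 < p) (hp1 : p < 1) (hC : Cbar delta p < 1)
  (xs : 'cV[R]_n) (hxs : lp_minimizer A y eps p xs) :
  let T0c := [set i : 'I_n | (k <= val i)%N] in
  let D0 := 2 * Dbar delta p / (1 - Cbar delta p) in
  let D1 := 2 `^ p / (1 - delta) `^ (p / 2) *
            (1 + 2 * Dbar delta p / (1 - Cbar delta p)) in
  l2norm (x - xs) `^ p <=
    D0 * (k%:R) `^ (p / 2 - 1) * (lpnorm p (restrictT x T0c)) `^ p
    + D1 * eps `^ p
  /\ (eps = 0 -> sparse k x -> xs = x).
Proof.
move=> T0c D0 D1.
have [feas opt] := hxs.
have d01 : Num.sqrt 2 / 2 <= delta < 1 by rewrite hdl hdu.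
have p01 : 0 < p < 1 by rewrite hp0 hp1.
have yx : y - A *m x = e by rewrite hy [LHS]addrAC subrr add0r.
have Ah : l2norm (A *m (x - xs)) <= 2 * eps.
  have -> : A *m (x - xs) = (y - A *m xs) - e.
    by rewrite hy mulmxBr [RHS]addrAC addrK.
  by apply: le_trans (l2normD _ _) _; rewrite l2normN; lra.
have xsx : lpnorm p xs <= lpnorm p x by apply: opt; rewrite yx.
(* The hole leaves [bound] quantified over the index set. *)
have bound := lp_recovery A delta p eps x xs _ hk hn hric.1 d01 p01 hC heps Ah xsx.
split.
  rewrite /T0c -(finset.setCK [set i : 'I_n | _]); apply: bound.
  have le_kn : (k <= n)%N by rewrite hn leq_pmull.
  apply: (@leq_trans #|[set widen_ord le_kn j | j : 'I_k]|); last first.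
    by rewrite -[leqRHS]card_ord leq_imset_card.
  apply/subset_leq_card/fintype.subsetP => i; rewrite !inE -ltnNge => ik.
  by apply/imsetP; exists (Ordinal ik) => //; apply: val_inj.
(* Unfolding [sparse] makes the support of [x] the index set. The noise term vanishes as [p] is
   nonzero, and [x] is zero off its support. *)
move=> eps0; rewrite /sparse => /bound; rewrite eps0 (powR0 (lt0r_neq0 hp0)) mulr0 addr0.
rewrite powR_lpnorm_restrictT// big1 ?mulr0 => [|i]; last first.
  by rewrite !inE negbK => /eqP ->; rewrite normr0 powR0 ?gt_eqF.
move=> H; apply/esym/subr0_eq/l2norm_eq0.
by move: H; rewrite le_eqVlt ltNge powR_ge0 orbF powR_eq0 => /andP[/eqP].
Qed.
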